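(* Let $n\ge 4$ be even, let $A\subseteq\mathcal{M}$ be a set of pairwise disjoint matches and let $B\subseteq R$. If $|A|+|B|$ is odd, then $$\sum_{M\in\mathfrak{M}}\sum_{r\in B}\left\lceil\frac{1+|M\cap A|}{2}\right\rceil y_{M,r} + \sum_{M\in\mathfrak{M}}\sum_{r\in R\setminus B}\left\lceil\frac{|M\cap A|}{2}\right\rceil y_{M,r} \;\ge\; \frac{1+|A|+|B|}{2}$$ is a valid inequality for the matching formulation, i.e., it is satisfied by every feasible point $y\in\{0,1\}^{\mathfrak{M}\times R}$ of the matching formulation. In particular, it is a Chvátal–Gomory cut derived from the LP relaxation of the matching formulation.
   Context: $T$ is a set of $n$ teams; $\mathcal{M} = \{\{i,j\}: i,j\in T, i\ne j\}$ is the set of matches; $R = \{1,\dots,n-1\}$ is the set of rounds; $\mathfrak{M}$ is the set of all perfect matchings $M\subseteq\mathcal{M}$ of the complete graph $K_n=(T,\mathcal{M})$. Two matches are disjoint if they have no team in common. The feasible points of the matching formulation of the single round robin problem are the $y\in\{0,1\}^{\mathfrak{M}\times R}$ with $\sum_{M\in\mathfrak{M}} y_{M,r} = 1$ for all $r\in R$ and $\sum_{M\in\mathfrak{M}: m\in M}\sum_{r\in R} y_{M,r} = 1$ for all $m\in\mathcal{M}$. The LP relaxation replaces $y\in\{0,1\}^{\mathfrak{M}\times R}$ by $y\ge 0$. For a polyhedron $\{y\ge 0: Dy = b\}$, a Chvátal–Gomory cut is an inequality of the form $\lceil u^{\top}D\rceil y\ge\lceil u^{\top}b\rceil$ for a real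 multiplier vector $u$, where rounding is componentwise. *)

(* Defs.v *)
From HB Require Import structures.
From mathcomp Require Import all_boot all_order all_algebra.
From mathcomp Require Import reals.
Set Implicit Arguments.
Unset Strict Implicit.
Unset Printing Implicit Defensive.
Import Order.TTheory GRing.Theory Num.Theory.
Local Open Scope ring_scope.

Section ChvatalGomory.
Variables (K : realType) (I J : finType).

Definition std_polyhedron (D : I -> J -> K) (b : I -> K) (y : J -> K) : Prop :=
  (forall j, 0 <= y j) /\ (forall i, \sum_j D i j * y j = b i).

(* The inequality [\sum_j a j * y j >= beta], read syntactically as the pair
   [(a, beta)], is a Chvatal-Gomory cut for [std_polyhedron D b]. *)
Definition is_CG_cut (D : I -> J -> K) (b : I -> K) (a : J -> K) (beta : K)
    : Prop :=
  exists u : I -> K,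
    (forall j, a j = (Num.ceil (\sum_i u i * D i j))%:~R) /\
    beta = (Num.ceil (\sum_i u i * b i))%:~R.

End ChvatalGomory.

Definition is_team_pair (T : finType) (m : {set T}) : bool := #|m| == 2%N.

(* The matches of the complete graph on T. *)
Definition team_pair (T : finType) := {m : {set T} | is_team_pair m}.

Definition is_perfect_matching (T : finType) (M : {set team_pair T}) : bool :=
  [forall i : T, #|[set m in M | i \in val m]| == 1%N].

Definition perfect_matching (T : finType) :=
  {M : {set team_pair T} | is_perfect_matching M}.

Definition pairwise_disjoint (T : finType) (A : {set team_pair T}) : Prop :=
  {in A &, forall m1 m2 : team_pair T, m1 != m2 -> [disjoint val m1 & val m2]}.

(* The rounds {1, ..., n-1} are shifted to {0, ..., n-2}. *)
Definition round (n : nat) := 'I_n.-1.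

Section MatchingFormulation.
Variables (K : realType) (T : finType) (n : nat).

Definition var_index : finType := (perfect_matching T * round n)%type.

Definition matching_constraints (y : var_index -> K) : Prop :=
  (forall r : round n, \sum_(M : perfect_matching T) y (M, r) = 1) /\
  (forall m : team_pair T,
     \sum_(M : perfect_matching T | m \in val M) \sum_(r : round n) y (M, r)
       = 1).

Definition matching_feasible (y : var_index -> K) : Prop :=
  (forall c, y c = 0 \/ y c = 1) /\ matching_constraints y.

Definition matching_relaxation (y : var_index -> K) : Prop :=
  (forall c, 0 <= y c) /\ matching_constraints y.

(* Rows [inl r] are the round constraints, rows [inr m] the match
   constraints. *)
Definition matching_row : finType := (round n + team_pair T)%type.

Definition matching_matrix (i : matching_row) (c : var_index) : K :=
  match i with
  | inl r => (c.2 == r)%:R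
  | inr m => (m \in val c.1)%:R
  end.

Definition matching_rhs (i : matching_row) : K := 1.

Lemma matching_relaxationE (y : var_index -> K) :
  matching_relaxation y <-> std_polyhedron matching_matrix matching_rhs y.
Proof.
have rowl r : \sum_c matching_matrix (inl r) c * y c =
    \sum_(M : perfect_matching T) y (M, r).
  transitivity (\sum_(M : perfect_matching T) \sum_(s : round n)
      (s == r)%:R * y (M, s)).
    by rewrite pair_big; apply: eq_big => // -[].
  apply: eq_bigr => M _; rewrite (bigD1 r) //= eqxx mul1r big1 ?addr0 //.
  by move=> s /negPf ->; rewrite mul0r.
have rowr m : \sum_c matching_matrix (inr m) c * y c =
    \sum_(M : perfect_matching T | m \in val M) \sum_(r : round n) y (M, r).
  transitivity (\sum_(M : perfect_matching T) \sum_(s : round n)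
      (m \in val M)%:R * y (M, s)).
    by rewrite pair_big; apply: eq_big => // -[].
  rewrite [RHS]big_mkcond; apply: eq_bigr => M _ /=.
  by rewrite -mulr_sumr; case: ifP; rewrite ?mul1r ?mul0r.
split=> -[y0].
- by move=> [h1 h2]; split=> // -[r|m]; rewrite ?rowl ?rowr.
- by move=> h; split=> //; split=> [r|m]; rewrite -?rowl -?rowr h.
Qed.

End MatchingFormulation.

(* Main.v *)
Require Import Defs.
From HB Require Import structures.
From mathcomp Require Import all_boot all_order all_algebra.
From mathcomp Require Import reals.
Set Implicit Arguments.
Unset Strict Implicit.
Unset Printing Implicit Defensive.
Import Order.TTheory GRing.Theory Num.Theory.
Local Open Scope ring_scope.

(** Give the multiplier 1/2 to the round constraint of every round in B and to
    the match constraint of every match in A, and 0 to all other rows.  The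
    aggregated constraint has coefficient ([r \in B] + |M :&: A|) / 2 at (M, r)
    and right-hand side (|A| + |B|) / 2; as |A| + |B| is odd, rounding the
    latter up gives (1 + |A| + |B|) / 2, so the inequality is the
    Chvatal-Gomory cut of these multipliers ([matching_cutP]).  Its validity at
    0/1 points is then an instance of the general soundness of such cuts
    ([CG_cut_valid]): at an integral point of the polyhedron the left-hand side
    is an integer that is at least the unrounded right-hand side. *)

(** * Validity of Chvatal-Gomory cuts *)

(** Rounding the coefficients up can only increase the left-hand side because
    y >= 0; integrality of the result then allows rounding the right-hand side
    up. *)
Lemma CG_cut_valid (K : realType) (I J : finType) (D : I -> J -> K)
    (b : I -> K) (a : J -> K) (beta : K) (y : J -> K) :
  is_CG_cut D b a beta -> std_polyhedron D b y ->
  (forall j, y j \is a Num.int) -> beta <= \sum_j a j * y j.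
Proof.
move=> [u [aE ->]] [y_ge0 yD] y_int.
have : \sum_j a j * y j \is a Num.int.
  by apply: rpred_sum => j _; rewrite rpredM // aE intr_int.
case/intrP => z zE; rewrite zE ler_int ceil_le_int -zE.
have -> : \sum_i u i * b i = \sum_j (\sum_i u i * D i j) * y j.
  under eq_bigr => i _ do rewrite -yD mulr_sumr.
  rewrite exchange_big; apply: eq_bigr => j _.
  by rewrite mulr_suml; apply: eq_bigr => i _; rewrite mulrA.
by apply: ler_sum => j _; rewrite ler_wpM2r // aE ceil_ge.
Qed.

Lemma ceil_half_odd (K : realType) (k : nat) :
  odd k -> (Num.ceil (k%:R / 2 : K))%:~R = k.+1%:R / 2 :> K.
Proof.
move=> k_odd; have kE : k = k./2.*2.+1 by rewrite -[LHS]odd_double_half k_odd.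
have half_succ : k.+1%:R / 2 = (k./2.+1%:Z)%:~R :> K.
  by rewrite {1}kE -doubleS -muln2 natrM mulfK // pnatr_eq0.
rewrite half_succ; congr _%:~R; apply/ceil_def.
rewrite -half_succ intrD -half_succ.
have -> : k.+1%:R / 2 + (-1)%:~R = k.-1%:R / 2 :> K.
  by rewrite kE /= -addn2 natrD mulrDl divff ?pnatr_eq0 // addrK.
rewrite ltr_pM2r ?ler_pM2r ?invr_gt0 ?ltr0n // ltr_nat ler_nat kE /=.
by rewrite ltnSn leqnSn.
Qed.

(** * The cut for the matching formulation *)

Definition half_multiplier (K : realType) (T : finType) (n : nat)
    (A : {set team_pair T}) (B : {set round n}) (i : matching_row T n) : K :=
  match i with inl r => (r \in B)%:R / 2 | inr m => (m \in A)%:R / 2 end.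

Lemma half_multiplier_rhs (K : realType) (T : finType) (n : nat)
    (A : {set team_pair T}) (B : {set round n}) :
  \sum_i half_multiplier K A B i * matching_rhs K i = (#|A| + #|B|)%:R / 2.
Proof.
rewrite /matching_rhs; under eq_bigr do rewrite mulr1.
rewrite big_sumType /= -!mulr_suml -mulrDl -!natr_sum -natrD.
by rewrite addnC -!sum1_card; congr ((_ + _)%:R / _); rewrite [RHS]big_mkcond.
Qed.

Lemma half_multiplier_coef (K : realType) (T : finType) (n : nat)
    (A : {set team_pair T}) (B : {set round n}) (c : var_index T n) :
  \sum_i half_multiplier K A B i * matching_matrix K i c
    = ((c.2 \in B) + #|val c.1 :&: A|)%:R / 2.
Proof.
rewrite big_sumType /= natrD mulrDl; congr (_ + _).
  rewrite (bigD1 c.2) //= eqxx mulr1 big1 ?addr0 // => r.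
  by rewrite eq_sym => /negPf ->; rewrite mulr0.
rewrite -sum1_card natr_sum mulr_suml [RHS]big_mkcond; apply: eq_bigr => m _.
by rewrite inE andbC; do 2!case: (_ \in _); rewrite /= ?(mulr0, mul0r, mulr1).
Qed.

Lemma matching_cutP (K : realType) (T : finType) (n : nat)
    (A : {set team_pair T}) (B : {set round n}) :
  odd (#|A| + #|B|) ->
  is_CG_cut (@matching_matrix K T n) (@matching_rhs K T n)
    (fun c : var_index T n =>
       if c.2 \in B then (Num.ceil ((1 + #|val c.1 :&: A|)%:R / 2 : K))%:~R
       else (Num.ceil (#|val c.1 :&: A|%:R / 2 : K))%:~R)
    ((1 + #|A| + #|B|)%:R / 2).
Proof.
move=> AB_odd; exists (half_multiplier K A B); split=> [c|].
  by rewrite half_multiplier_coef; case: (c.2 \in B).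
by rewrite half_multiplier_rhs ceil_half_odd.
Qed.

Theorem proposition4p3 (K : realType) (T : finType) (n : nat)
    (cardT : #|T| = n) (n_ge4 : (4 <= n)%N) (n_even : ~~ odd n)
    (A : {set team_pair T}) (A_disj : pairwise_disjoint A)
    (B : {set round n}) (AB_odd : odd (#|A| + #|B|)) :
  (forall y : var_index T n -> K, matching_feasible y ->
     \sum_(M : perfect_matching T) \sum_(r in B)
        (Num.ceil ((1 + #|val M :&: A|)%:R / 2 : K))%:~R * y (M, r)
     + \sum_(M : perfect_matching T) \sum_(r in ~: B)
        (Num.ceil (#|val M :&: A|%:R / 2 : K))%:~R * y (M, r)
     >= (1 + #|A| + #|B|)%:R / 2) /\
  is_CG_cut (@matching_matrix K T n) (@matching_rhs K T n)
    (fun c : var_index T n =>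
       if c.2 \in B then (Num.ceil ((1 + #|val c.1 :&: A|)%:R / 2 : K))%:~R
       else (Num.ceil (#|val c.1 :&: A|%:R / 2 : K))%:~R)
    ((1 + #|A| + #|B|)%:R / 2).
Proof.
have cut := matching_cutP K AB_odd; split=> // y [y01 y_constr].
have y_poly : std_polyhedron (@matching_matrix K T n) (@matching_rhs K T n) y.
  by apply/matching_relaxationE; split=> // c; case: (y01 c) => ->.
have y_int c : y c \is a Num.int by case: (y01 c) => ->.
apply: le_trans (CG_cut_valid cut y_poly y_int) _; rewrite le_eqVlt.
apply/orP; left; apply/eqP; rewrite -big_split /=.
transitivity (\sum_(M : perfect_matching T) \sum_(r : round n)
    (if r \in B then (Num.ceil ((1 + #|val M :&: A|)%:R / 2 : K))%:~R
     else (Num.ceil (#|val M :&: A|%:R / 2 : K))%:~R) * y (M, r)).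
  by rewrite pair_big; apply: eq_big => // -[].
apply: eq_bigr => M _; rewrite (bigID (mem B)) /=; congr (_ + _).
  by apply: eq_bigr => r ->.
by apply: eq_big => [r|r /negPf ->]; rewrite ?inE.
Qed.
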